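(* Let $\sigma\colon(\mathcal M,L)\to(\mathcal B,\tilde L)$ be a pseudo-Finsler submersion, with fundamental tensors $g$ and $\tilde g$. For each horizontal $v\in T_p\mathcal M$, with $\tilde v=d\sigma(v)$, the linear map $d\sigma|_p\colon T_p\mathcal M\to T_{\sigma(p)}\mathcal B$ is a pseudo-Riemannian submersion from $(T_p\mathcal M,g_v)$ to $(T_{\sigma(p)}\mathcal B,\tilde g_{\tilde v})$, namely $$g_v(x,y)=\tilde g_{\tilde v}(d\sigma(x),d\sigma(y))$$ for all $x,y\in T_p\mathcal M$ that are $g_v$-orthogonal to the vertical vectors at $p$. In particular, $g_v(x,e)=\tilde g_{\tilde v}(d\sigma(x),d\sigma(e))$ for every such $x$ and every $e\in T_p\mathcal M$.
   Context: A pseudo-Finsler metric on $\mathcal M$ is a smooth $L\colon\mathcal A\to\mathbb R$, $\mathcal A\subset T\mathcal M\setminus\mathbf 0$ open and invariant under positive scalar multiplication, with $L(\lambda v)=\lambda^2L(v)$ for $\lambda>0$ and with non-degenerate fundamental tensor $g_v(e,h)=\frac12\frac{\partial^2}{\partial s\partial t}L(v+se+th)|_{s=t=0}$ for every $v\in\mathcal A$ (elements of $\mathcal A$ are called admissible). Let $\sigma\colon\mathcal M\to\mathcal B$ be a surjective map with surjective differential; vertical vectors at $p$ are the elements of $\mathcal V_p=\ker d\sigma_p$. An admissible $v\in T_p\mathcal M$ is horizontal if $g_v(v,w)=0$ for all $w\in\mathcal V_p$. $\sigma\colon(\mathcal M,L)\to(\mathcal B,\tilde L)$ is a pseudo-Finsler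 submersion if (i) the restriction of $L$ to the tangent spaces of the fibers is a pseudo-Finsler metric on each fiber, and (ii) $L(v)=\tilde L(d\sigma(v))$ for every horizontal $v$ (in particular $d\sigma(v)$ is admissible for $\tilde L$). For every horizontal $v$ the vertical space $\mathcal V_p$ is $g_v$-non-degenerate. *)

(* Defs.v *)
From HB Require Import structures.
From mathcomp Require Import all_boot all_order all_algebra.
From mathcomp Require Import all_classical all_reals all_analysis.

Set Implicit Arguments.
Unset Strict Implicit.
Unset Printing Implicit Defensive.
Import Order.TTheory GRing.Theory Num.Theory.
Import numFieldNormedType.Exports.
Local Open Scope classical_set_scope.
Local Open Scope ring_scope.

(* On an open set of a finite-dimensional space, C^k amounts to asking that
   every iterated directional derivative of order < k be differentiable and
   those of order k be continuous. *)
Fixpoint Ck_on (R : realType) (V W : normedModType R) (k : nat) (U : set V)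
    (f : V -> W) : Prop :=
  if k is k'.+1 then
    (forall x, U x -> differentiable f x) /\ (forall v, Ck_on k' U ('D_v f))
  else forall x, U x -> {for x, continuous f}.

Definition smooth_on (R : realType) (V W : normedModType R) (U : set V)
    (f : V -> W) : Prop :=
  forall k, Ck_on k U f.

(* A smooth atlas, not required to be maximal. The map [param i] is the inverse
   of the homeomorphism [coord i : dom i -> coord i @` dom i]; the values of
   [coord i] off [dom i] and of [param i] off [coord i @` dom i] are junk. *)
Record manifold (R : realType) (n : nat) := Manifold {
  carrier :> topologicalType ;
  chart : Type ;
  dom : chart -> set carrier ;
  coord : chart -> carrier -> 'rV[R]_n ;
  param : chart -> 'rV[R]_n -> carrier ;
  hausdorff_carrier : hausdorff_space carrier ;
  second_countable_carrier : @second_countable carrier ;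
  dom_open : forall i, open (dom i) ;
  dom_cover : forall p, exists i, dom i p ;
  coordK : forall i p, dom i p -> param i (coord i p) = p ;
  codom_open : forall i, open (coord i @` dom i) ;
  coord_continuous : forall i p, dom i p -> {for p, continuous (coord i)} ;
  param_continuous :
    forall i x, (coord i @` dom i) x -> {for x, continuous (param i)} ;
  transition_smooth : forall i j,
    smooth_on (coord i @` (dom i `&` dom j)) (coord j \o param i) }.

Definition local_expr (R : realType) (m n : nat) (M : manifold R m)
    (N : manifold R n) (f : M -> N) (i : chart M) (j : chart N) :
    'rV[R]_m -> 'rV[R]_n :=
  fun x => coord j (f (param i x)).

Definition is_smooth (R : realType) (m n : nat) (M : manifold R m)
    (N : manifold R n) (f : M -> N) : Prop :=
  continuous f /\
  forall i j, smooth_on (coord i @` (dom i `&` f @^-1` dom j))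
                        (local_expr f i j).

Record smooth_map (R : realType) (m n : nat) (M : manifold R m)
    (N : manifold R n) := SmoothMap {
  map_of :> M -> N ;
  map_smooth : is_smooth map_of }.

Section ChainRule.
Context {R : realType}.

Lemma eq_near_diff (V W : normedModType R) (f g : V -> W) (x : V) :
  differentiable f x -> differentiable g x -> (\forall y \near x, f y = g y) ->
  'd f x =1 'd g x.
Proof.
move=> df dg fg v; have [->|v0] := eqVneq v 0; first by rewrite !linear0.
by rewrite -(deriveE v df) -(deriveE v dg); exact: near_eq_derive.
Qed.

Lemma local_expr_differentiable (m n : nat) (M : manifold R m)
    (N : manifold R n) (f : M -> N) i j p : is_smooth f ->
  dom i p -> dom j (f p) -> differentiable (local_expr f i j) (coord i p).
Proof.
by move=> [_ /(_ i j 1%N)[+ _]] ip jp; apply; exists p.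
Qed.

Lemma diff_local_expr_comp (m n k : nat) (M : manifold R m) (N : manifold R n)
    (P : manifold R k) (f : M -> N) (g : N -> P) i j l p :
  is_smooth f -> is_smooth g -> is_smooth (g \o f) ->
  dom i p -> dom j (f p) -> dom l (g (f p)) ->
  forall x, 'd (local_expr (g \o f) i l) (coord i p) x =
    'd (local_expr g j l) (coord j (f p))
      ('d (local_expr f i j) (coord i p) x).
Proof.
move=> sf sg sgf ip jp lp x.
have dg : differentiable (local_expr g j l) (local_expr f i j (coord i p)).
  by rewrite /local_expr coordK//; exact: local_expr_differentiable.
have df : differentiable (local_expr f i j) (coord i p).
  exact: local_expr_differentiable.
have jE : coord j (f p) = local_expr f i j (coord i p).
  by rewrite /local_expr coordK.
have compE := congr1 (@^~ x) (diff_comp df dg).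
rewrite jE; apply: etrans compE.
apply: eq_near_diff.
- exact: local_expr_differentiable.
- exact: differentiable_comp.
have ci : (coord i @` dom i) (coord i p) by exists p.
have : {for coord i p, continuous (f \o param i)}.
  apply: continuous_comp; first exact: param_continuous.
  by apply: sf.1.
move/(_ (dom j)); rewrite /= coordK// => /(_ (open_nbhs_nbhs _)) H.
have {}H := H (conj (@dom_open _ _ N j) jp).
near=> y; rewrite /local_expr /= coordK//.
by near: y; exact: H.
Unshelve. all: by end_near. Qed.

End ChainRule.

Lemma id_smooth (R : realType) (n : nat) (M : manifold R n) :
  is_smooth (@id M).
Proof. by split=> [x//|i j]; exact: transition_smooth. Qed.

(* A tangent vector at p is the family of its components in the charts around
   p, related by the differentials of the transition maps (and 0 in the other
   charts). *)
Section Tangent.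
Context {R : realType} {n : nat} (M : manifold R n) (p : M).

Definition tangent_compatible (X : chart M -> 'rV[R]_n) : Prop :=
  (forall i, ~ dom i p -> X i = 0) /\
  (forall i j, dom i p -> dom j p ->
    X j = 'd (coord j \o param i) (coord i p) (X i)).

Definition tangent_pred : {pred chart M -> 'rV[R]_n} :=
  fun X => `[< tangent_compatible X >].

Lemma tangent_submod_closed : submod_closed tangent_pred.
Proof.
split; first by apply/asboolP; split=> // i j _ _; rewrite linear0.
move=> a X Y /asboolP[X0 XE] /asboolP[Y0 YE]; apply/asboolP; split.
  move=> i ip.
  by rewrite [LHS](_ : _ = a *: X i + Y i)// X0// Y0// scaler0 addr0.
move=> i j ip jp.
rewrite [LHS](_ : _ = a *: X j + Y j)//.
by rewrite [in RHS](_ : (a *: X + Y) i = a *: X i + Y i)// linearP -XE// -YE.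
Qed.

HB.instance Definition _ :=
  GRing.isSubmodClosed.Build R (chart M -> 'rV[R]_n) tangent_pred
    tangent_submod_closed.

Record tangent := Tangent {
  component :> chart M -> 'rV[R]_n ;
  componentP : component \in tangent_pred }.

HB.instance Definition _ := [isSub for component].
HB.instance Definition _ := [Choice of tangent by <:].
HB.instance Definition _ := [SubChoice_isSubLmodule of tangent by <:].

End Tangent.

Section TangentVector.
Context {R : realType} {n : nat} (M : manifold R n) (i : chart M) (p : M).

Definition tangent_of_component_fun (y : 'rV[R]_n) : chart M -> 'rV[R]_n :=
  fun j => if `[< dom i p /\ dom j p >]
           then 'd (coord j \o param i) (coord i p) y else 0.

Lemma tangent_of_componentP y : tangent_of_component_fun y \in tangent_pred p.
Proof.
apply/asboolP; split=> [j jp|j k jp kp]; rewrite /tangent_of_component_fun.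
  by case: asboolP => // -[].
case: asboolP => [[ip _]|ip]; last first.
  case: asboolP => [[ip' _]|_]; first by case: ip.
  by rewrite linear0.
have id_sm := @id_smooth R n M.
case: asboolP => [_|[]//].
exact: (@diff_local_expr_comp R n n n M M M id id i j k p).
Qed.

(* The tangent vector at p with component y in the chart i; 0 if i is not a
   chart around p. *)
Definition tangent_of_component (y : 'rV[R]_n) : tangent p :=
  Tangent (tangent_of_componentP y).

End TangentVector.

Section Differential.
Context {R : realType} {m n : nat} {M : manifold R m} {N : manifold R n}.
Variables (f : smooth_map M N) (p : M).

Definition chart_at : chart M := projT1 (cid (dom_cover p)).

Lemma dom_chart_at : dom chart_at p.
Proof. exact: projT2 (cid (dom_cover p)). Qed.

Definition dmap_fun (X : tangent p) : chart N -> 'rV[R]_n :=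
  fun j => if `[< dom j (f p) >]
           then 'd (local_expr f chart_at j) (coord chart_at p) (X chart_at)
           else 0.

Lemma dmap_subproof X : dmap_fun X \in tangent_pred (f p).
Proof.
apply/asboolP; split=> [j jp|j k jp kp]; rewrite /dmap_fun.
  by case: asboolP.
case: asboolP => // _; case: asboolP => // _.
exact: (@diff_local_expr_comp R m n n M N N f id _ j k p (map_smooth f)
  (@id_smooth _ _ N) (map_smooth f) dom_chart_at).
Qed.

Definition dmap (X : tangent p) : tangent (f p) := Tangent (dmap_subproof X).

(* The auxiliary choice of a chart at p is immaterial. *)
Lemma dmapE (X : tangent p) i j : dom i p -> dom j (f p) ->
  dmap X j = 'd (local_expr f i j) (coord i p) (X i).
Proof.
move=> ip jp; rewrite /dmap /= /dmap_fun; case: asboolP => // _.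
have [_ XE] := asboolP _ (componentP X).
rewrite (XE chart_at i)//; last exact: dom_chart_at.
exact: (@diff_local_expr_comp R m m n M M N id f _ i j p
  (@id_smooth _ _ M) (map_smooth f) (map_smooth f) dom_chart_at).
Qed.

Lemma dmap_linear : linear dmap.
Proof.
move=> a X Y; apply/val_inj/funext => j /=.
rewrite [RHS](_ : _ = a *: dmap_fun X j + dmap_fun Y j)// /dmap_fun.
case: asboolP => _; last by rewrite scaler0 addr0.
rewrite [X in 'd _ _ X = _](_ : _ = a *: X chart_at + Y chart_at)//.
by rewrite linearP.
Qed.

HB.instance Definition _ :=
  GRing.isLinear.Build R (tangent p) (tangent (f p)) _ dmap dmap_linear.

End Differential.

(* A subset of TM, and a function on TM; a function defined only on a subset A
   of TM is given by a total one whose values off A are irrelevant. *)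
Definition tangent_set (R : realType) (n : nat) (M : manifold R n) :=
  forall p : M, set (tangent p).
Definition tangent_fun (R : realType) (n : nat) (M : manifold R n) :=
  forall p : M, tangent p -> R.

Arguments dmap {R m n M N} f p X.

Section BundleCharts.
Context {R : realType} {n : nat} {M : manifold R n}.

Definition bundle_set (A : tangent_set M) (i : chart M) :
    set ('rV[R]_n * 'rV[R]_n) :=
  [set z | (coord i @` dom i) z.1 /\
           A (param i z.1) (tangent_of_component i (param i z.1) z.2)].

Definition bundle_fun (L : tangent_fun M) (i : chart M) :
    'rV[R]_n * 'rV[R]_n -> R :=
  fun z => L (param i z.1) (tangent_of_component i (param i z.1) z.2).

End BundleCharts.

Definition fundamental_tensor (R : realType) (V : lmodType R) (L : V -> R)
    (v e h : V) : R :=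
  2^-1 *
  derive1 (fun s : R => derive1 (fun t : R => L (v + s *: e + t *: h)) 0) 0.

Record pseudo_finsler (R : realType) (n : nat) (M : manifold R n)
    (A : tangent_set M) (L : tangent_fun M) : Prop := PseudoFinsler {
  pf_nonzero : forall p, ~ A p 0 ;
  pf_open : forall i, open (bundle_set A i) ;
  pf_cone : forall p v (c : R), 0 < c -> A p v -> A p (c *: v) ;
  pf_smooth : forall i, smooth_on (bundle_set A i) (bundle_fun L i) ;
  pf_homogeneous : forall p v (c : R), 0 < c -> A p v ->
    L p (c *: v) = c ^+ 2 * L p v ;
  pf_nondegenerate : forall p v, A p v ->
    forall e, (forall h, fundamental_tensor (L p) v e h = 0) -> e = 0 }.

Definition orthogonal_to (R : realType) (V : lmodType R) (g : V -> V -> R)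
    (K : set V) (x : V) : Prop :=
  forall w, K w -> g x w = 0.

Definition nondegenerate_on (R : realType) (V : lmodType R) (g : V -> V -> R)
    (K : set V) : Prop :=
  forall w, K w -> orthogonal_to g K w -> w = 0.

Definition kernel (R : realType) (V W : lmodType R) (f : {linear V -> W}) :
    set V :=
  [set x | f x = 0].

Record pseudo_riemannian_submersion (R : realType) (V W : lmodType R)
    (gV : V -> V -> R) (gW : W -> W -> R) (f : {linear V -> W}) : Prop :=
  PseudoRiemannianSubmersion {
  prs_surjective : forall y, exists x, f x = y ;
  prs_nondegenerate : nondegenerate_on gV (kernel f) ;
  prs_isometric : forall x y,
    orthogonal_to gV (kernel f) x -> orthogonal_to gV (kernel f) y ->
    gV x y = gW (f x) (f y) }.

Section Submersion.
Context {R : realType} {m n : nat} {M : manifold R m} {B : manifold R n}.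

Definition vertical (sigma : smooth_map M B) (p : M) : set (tangent p) :=
  kernel (dmap sigma p).

Arguments vertical : clear implicits.

Definition horizontal (A : tangent_set M) (L : tangent_fun M)
    (sigma : smooth_map M B) (p : M) (v : tangent p) : Prop :=
  A p v /\ orthogonal_to (fundamental_tensor (L p) v) (vertical sigma p) v.

(* The fiber over b with its structure of embedded submanifold of M: the image
   of an injective immersion which is a homeomorphism onto its image. When
   sigma is a submersion such an F exists and is unique up to diffeomorphism. *)
Record fiber_embedding (sigma : smooth_map M B) (b : B) (k : nat)
    (F : manifold R k) (iota : smooth_map F M) : Prop := FiberEmbedding {
  fe_injective : injective iota ;
  fe_immersion : forall q : F, injective (dmap iota q) ;
  fe_open : forall O : set F, open O -> exists2 U : set M,
    open U & O = iota @^-1` U ;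
  fe_range : range iota = sigma @^-1` [set b] }.

Record pseudo_finsler_submersion (A : tangent_set M) (L : tangent_fun M)
    (A' : tangent_set B) (L' : tangent_fun B) (sigma : smooth_map M B) : Prop :=
  PseudoFinslerSubmersion {
  pfs_surjective : forall b, exists p, sigma p = b ;
  pfs_dmap_surjective : forall p (y : tangent (sigma p)),
    exists x : tangent p, dmap sigma p x = y ;
  pfs_fiber : forall b, exists (k : nat) (F : manifold R k)
      (iota : smooth_map F M),
    fiber_embedding sigma b iota /\
    pseudo_finsler (fun q => [set x : tangent q | A (iota q) (dmap iota q x)])
                   (fun q x => L (iota q) (dmap iota q x)) ;
  pfs_horizontal : forall p (v : tangent p), horizontal A L sigma v ->
    A' (sigma p) (dmap sigma p v) /\ L p v = L' (sigma p) (dmap sigma p v) }.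

End Submersion.

Arguments vertical {R m n M B} sigma p.

(* Main.v *)
(* Fix p and view L and L~ as functions on T_pM and T_{sigma(p)}B, with
   f = d sigma_p. By Euler's identity u is horizontal iff dL_u vanishes on ker f.
   Since ker f is g_v-nondegenerate, the implicit function theorem provides, for
   every x orthogonal to ker f, a curve c of horizontal vectors with c(0) = v and
   c'(0) = x. Differentiating L = L~ o f along such curves gives
   dL_u = dL~_{f u} o f at every horizontal u; differentiating this identity once
   more along c gives g_v(x, e) = g~_{f v}(f x, f e) for all e. *)

Require Import Defs.
From HB Require Import structures.
From mathcomp Require Import all_boot all_order all_algebra.
From mathcomp Require Import all_classical all_reals all_analysis.
From mathcomp Require Import ring lra.

Set Implicit Arguments.
Unset Strict Implicit.
Unset Printing Implicit Defensive.
Import Order.TTheory GRing.Theory Num.Theory.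
Import numFieldNormedType.Exports.
Local Open Scope classical_set_scope.
Local Open Scope ring_scope.

(* Matrices are complete and normed, but the join of the two structures is not
   registered in the library. *)
HB.instance Definition _ (R : realType) (m n : nat) :=
  Complete.on (matrix R m n).

(** * Strict differentiability and curves in a zero set *)

(** Both points vary near [v]: for linear [D], this says that [f - D] has arbitrarily small
    Lipschitz constant near [v], the form that a contraction argument consumes. *)
Definition strictly_differentiable (R : realType) (V W : normedModType R)
    (f D : V -> W) (v : V) : Prop :=
  forall e : R, 0 < e -> \forall z \near nbhs (v, v),
    `|f z.1 - f z.2 - D (z.1 - z.2)| <= e * `|z.1 - z.2|.

Section ImplicitCurve.
Context {R : realType} {V : completeNormedModType R}.
Variables (Theta : V -> V) (D : {linear V -> V}) (v x : V).
Hypotheses (D_continuous : continuous D)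
  (Theta_sdiff : strictly_differentiable Theta D v)
  (D_Theta : forall a, D (Theta a) = Theta a)
  (Theta0 : Theta v = 0) (Dx : D x = 0).

(** This is strict differentiability at the pair [(v + s *: x, v)]: [D] kills the increment [s *: x]
    and [Theta v = 0]. *)
Lemma Theta_line_near (e : R) : 0 < e ->
  \forall s \near (0 : R), `|Theta (v + s *: x)| <= e * `|s| * `|x|.
Proof.
move=> /Theta_sdiff.
have : (v + s *: x, v) @[s --> (0 : R)] --> (v + 0 *: x, v).
  apply: (@cvg_pair _ _ _ _ (nbhs (v + 0 *: x)) (nbhs v)); last exact: cvg_cst.
  by apply: cvgD; [exact: cvg_cst|apply: cvgZr_tmp; exact: cvg_id].
rewrite scale0r addr0.
move=> cv /cv; rewrite nbhs_simpl /=; apply: filterS => s /=.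
by rewrite Theta0 subr0 addrAC subrr add0r linearZ_LR Dx scaler0 subr0 normrZ mulrA.
Qed.

(* w is a fixed point of [w |-> w - Theta (v + s *: x + w)], which is a
   contraction on [D w = w] since there its derivative [id - D] vanishes. *)
Lemma Theta_correction_near : \forall s \near (0 : R), exists w,
  Theta (v + s *: x + w) = 0 /\ `|w| <= 2 * `|Theta (v + s *: x)|.
Proof.
have h2 : 0 < 2^-1 :> R by [].
have [/= d d0 dP] := (nbhs_ballP _ _).1 (Theta_sdiff h2).
have line := Theta_line_near h2.
(* This keeps [v + s *: x + w] in the ball where the strict estimate holds, since both [s *: x] and
   the correction [w] have norm at most [|s| * |x|]. *)
have small : \forall s \near (0 : R), 2 * (`|s| * `|x|) < d.
  have : (2 * (`|s| * `|x|)) @[s --> (0 : R)] --> 2 * (`|0 : R| * `|x|).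
    apply: cvgMl_tmp; apply: cvgMr_tmp; apply: cvg_norm; exact: cvg_id.
  rewrite normr0 mul0r mulr0 => /(_ [set y | y < d]); apply.
  exact: lt_nbhsl.
near=> s.
have les : `|Theta (v + s *: x)| <= 2^-1 * `|s| * `|x| by near: s.
have sd : 2 * (`|s| * `|x|) < d by near: s.
(* The contraction has ratio 1/2 and moves 0 by [Theta u], so the ball of radius twice that
   displacement is stable. *)
set u := v + s *: x; set r := 2 * `|Theta u|.
have rle : r <= `|s| * `|x| by move: les; rewrite /r /u; lra.
pose U := [set w : V | D w = w /\ `|w| <= r].
have uball w : U w -> ball v d (u + w).
  move=> [_ wr]; rewrite -ball_normE /= /u opprD opprD addrA addrA subrr add0r.
  rewrite -opprD normrN; apply: le_lt_trans sd.
  apply: le_trans (ler_normD _ _) _; rewrite normrZ.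
  lra.
have lip w w' : U w -> U w' ->
    `|(w - Theta (u + w)) - (w' - Theta (u + w'))| <= 2^-1 * `|w - w'|.
  move=> Uw Uw'.
  have /= := dP (u + w, u + w') (conj (uball _ Uw) (uball _ Uw')).
  rewrite opprD [u + w + _]addrACA subrr add0r linearB/= Uw.1 Uw'.1 -normrN.
  congr (`|_| <= _).
  by rewrite [LHS]opprB opprB opprB addrACA [RHS]addrACA (addrC (- w')).
have U0 : U 0 by split; rewrite ?linear0// normr0 /r mulr_ge0.
have stable : set_fun U U (fun w => w - Theta (u + w)).
  move=> w Uw; split; first by rewrite linearB/= D_Theta Uw.1.
  have := lip _ _ Uw U0; rewrite subr0 addr0 sub0r opprK.
  set a := w - _; move=> h.
  have -> : a = (a + Theta u) - Theta u by rewrite addrK.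
  apply: le_trans (ler_normB _ _) _.
  have := Uw.2; rewrite /r; lra.
have clU : closed U.
  rewrite [U](_ : _ = [set w | D w - w = 0] `&` [set w | `|w| <= r]); last first.
    apply/seteqP; split=> w [] /=; last by move=> /subr0_eq.
    by move=> ->; rewrite subrr.
  apply: closedI.
    apply: (closed_comp (f := fun w => D w - w) (D := [set 0])) => [w _|].
      by apply: continuousB => //; exact: D_continuous.
    exact/accessible_closed_set1/hausdorff_accessible/norm_hausdorff.
  apply: (closed_comp (f := fun w : V => `|w|) (D := [set t | t <= r])) => [w _|].
    exact: norm_continuous.
  exact: closed_le.
pose G := mkfun_fun stable.
have ctr : is_contraction G.
  exists (2^-1)%:nng; split; first by rewrite /=; lra.
  by move=> [w w'] [/= Uw Uw'] /=; exact: lip.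
have [w [_ wr] wE] := banach_fixed_point ctr clU (ex_intro _ 0 U0).
exists w; split=> //.
by move/eqP: wE; rewrite /= -subr_eq0 opprB addrC subrK => /eqP.
Unshelve. all: by end_near. Qed.

(** The correction to the line [v + s *: x] is bounded by twice [Theta (v + s *: x)], which is o(s),
    so it does not change the velocity at 0. *)
Lemma implicit_curve : exists c : R -> V,
  [/\ c 0 = v, is_derive (0 : R) 1 c x & \forall s \near (0 : R), Theta (c s) = 0].
Proof.
pose w s := xget 0 [set w | Theta (v + s *: x + w) = 0 /\
                            `|w| <= 2 * `|Theta (v + s *: x)|].
have wP : \forall s \near (0 : R), Theta (v + s *: x + w s) = 0 /\
                            `|w s| <= 2 * `|Theta (v + s *: x)|.
  by apply: filterS Theta_correction_near => s /(xgetPex 0).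
(* At [s = 0] the norm bound leaves 0 as the only correction, so the curve starts at [v]. *)
have w0 : w 0 = 0.
  have [_] := nbhs_singleton wP.
  by rewrite scale0r addr0 Theta0 normr0 mulr0 normr_le0 => /eqP.
exists (fun s => v + s *: x + w s); split.
- by rewrite scale0r w0 !addr0.
- set c := fun s => _.
  suff cv : h^-1 *: (c (h *: 1 + 0) - c 0) @[h --> (0 : R)^'] --> x.
    by apply: DeriveDef; [apply/cvg_ex; exists x|exact: cvg_lim cv].
  apply/cvgrPdist_le => /= e e0.
  (* The 2 cancels the factor in the bound on [w h]; adding 1 keeps the divisor positive when
     [x = 0]. *)
  have e'0 : 0 < e / (2 * (`|x| + 1)).
    by rewrite divr_gt0// mulr_gt0// ltr_wpDl.
  near=> h.
  have h0 : h != 0 by near: h; exact: nbhs_dnbhs_neq.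
  have [_ wh] : Theta (v + h *: x + w h) = 0 /\
                `|w h| <= 2 * `|Theta (v + h *: x)|.
    by near: h; apply: nbhs_dnbhs; exact: wP.
  have Th : `|Theta (v + h *: x)| <= e / (2 * (`|x| + 1)) * `|h| * `|x|.
    by near: h; apply: nbhs_dnbhs; exact: Theta_line_near.
  have -> : x - h^-1 *: (c (h *: 1 + 0) - c 0) = - (h^-1 *: w h).
    rewrite /c addr0 scale0r w0 !addr0 [h *: 1]mulr1 addrAC [v + _]addrC addrK.
    by rewrite scalerDr scalerA mulVf// scale1r opprD addrA subrr add0r.
  rewrite normrN normrZ normfV ler_pdivrMl ?normr_gt0//.
  apply: (le_trans wh); apply: (le_trans (ler_wpM2l _ Th)) => //.
  rewrite -subr_ge0 [X in 0 <= X](_ : _ = e * `|h| * (1 - `|x| / (`|x| + 1))).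
    by rewrite !mulr_ge0// ?(ltW e0)// subr_ge0 ler_pdivrMr ?ltr_wpDl// mul1r lerDl.
  have : `|x| + 1 != 0 by rewrite gt_eqF// ltr_wpDl.
  by move=> ?; field.
- by apply: filterS wP => s [].
Unshelve. all: by end_near. Qed.
End ImplicitCurve.

(** * Derivatives along curves and strict differentiability of C^1 maps *)

Lemma is_derive_along (R : realType) (V W : normedModType R) (f : V -> W)
    (c : R -> V) (t : R) (x : V) :
  is_derive t 1 c x -> differentiable f (c t) ->
  is_derive t 1 (f \o c) ('d f (c t) x).
Proof.
move=> [dc cE] df.
have dct : differentiable c t by exact/derivable1_diffP.
have dfc := differentiable_comp dct df.
apply: DeriveDef; first exact/derivable1_diffP.
by rewrite deriveE// diff_comp//= -(deriveE _ dct) cE.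
Qed.

Lemma is_derive_line (R : realType) (V : normedModType R) (a w : V) (t : R) :
  is_derive t 1 (fun s : R => a + s *: w) w.
Proof.
have dl : is_diff t (fun s : R => a + s *: w) (fun s : R => s *: w).
  by apply: is_diff_eq; rewrite add0r.
apply: DeriveDef; first exact/derivable1_diffP.
by rewrite deriveE// diff_val scale1r.
Qed.

Section StrictDifferentiability.
Context {R : realType}.

Lemma row_entry_le_norm (m : nat) (w : 'rV[R]_m) j : `|w 0 j| <= `|w|.
Proof.
rewrite [leRHS]/Num.Def.normr/= mx_normrE.
exact: (le_bigmax _ (fun ij => `|w ij.1 ij.2|) (0, j)).
Qed.

Lemma linear_row_sum (m : nat) (W : lmodType R)
    (f : {linear 'rV[R]_m -> W}) (w : 'rV[R]_m) :
  f w = \sum_j w 0 j *: f (delta_mx 0 j).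
Proof.
by rewrite [in LHS](row_sum_delta w) linear_sum; apply: eq_bigr => j _; rewrite linearZ.
Qed.

Lemma linear_row_continuous (m : nat) (W : normedModType R)
    (f : {linear 'rV[R]_m -> W}) :
  continuous f.
Proof.
move=> w; rewrite (_ : f = (fun u => \sum_j u 0 j *: f (delta_mx 0 j)) :> (_ -> _)).
  apply: (@cvg_big _ _ _ _ xpredT _ _ (nbhs w)) => [|j _]; first exact: add_continuous.
  by apply: (@cvgZr_tmp _ _ _ (nbhs w)); exact: coord_continuous.
by apply/funext => u; exact: linear_row_sum.
Qed.

(** The mean value theorem on the segment from [b] to [a] gives [f a - f b] as ['d f y (a - b)] for
    some [y] on it, and the partial derivatives at [y] are close to those at [v]. This requires real
    values; row-valued maps are then handled entry by entry. *)
Lemma C1_strictly_differentiable (m : nat) (U : set 'rV[R]_m)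
    (f : 'rV[R]_m -> R) (v : 'rV[R]_m) : open U -> U v ->
  (forall x, U x -> differentiable f x) ->
  (forall w, {for v, continuous ('D_w f)}) ->
  strictly_differentiable f ('d f v) v.
Proof.
move=> Uo Uv fd cf e e0.
(* The [m] coordinate errors add up to at most [e]; the successor keeps the divisor nonzero when
   [m = 0]. *)
have e'0 : 0 < e / m.+1%:R by rewrite divr_gt0.
have near_df : \forall x \near v, U x /\ forall j : 'I_m,
    `|'D_(delta_mx 0 j) f x - 'D_(delta_mx 0 j) f v| <= e / m.+1%:R.
  near=> x; split; first by near: x; exact: open_nbhs_nbhs.
  near: x; apply: filter_forall => j.
  have /cvgr_dist_le/(_ _ e'0) := cf (delta_mx 0 j).
  by apply: filterS => x; rewrite distrC.
have [/= d d0 dP] := (nbhs_ballP _ _).1 near_df.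
apply/nbhs_ballP; exists d => //= -[a b] [/= ad bd].
pose l (t : R) : 'rV[R]_m := b + t *: (a - b).
have lball (t : R) : 0 <= t <= 1 -> ball v d (l t).
  move=> /andP[t0 t1]; move: ad bd; rewrite -!ball_normE /= => ad bd.
  have -> : v - l t = (1 - t) *: (v - b) + t *: (v - a).
    rewrite /l opprD addrA scalerBl scale1r -[RHS]addrA; congr (_ + _).
    rewrite [RHS]addrC -scalerBr -scalerN; congr (_ *: _).
    by rewrite !opprB [RHS]addrC addrA subrK.
  apply: (le_lt_trans (ler_normD _ _)); rewrite !normrZ.
  rewrite !ger0_norm ?subr_ge0//.
  (* The strict inequality is drawn from the term with factor [t], so [t = 0] is treated apart. *)
  have [->|t0'] := eqVneq t 0; first by rewrite subr0 mul1r mul0r addr0.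
  have -> : d = (1 - t) * d + t * d by ring.
  rewrite ler_ltD//; first by rewrite ler_wpM2l ?subr_ge0// ltW.
  by rewrite ltr_pM2l// lt_neqAle eq_sym t0' t0.
have ld (t : R) : t \in `[0, 1] -> is_derive t 1 (f \o l) ('d f (l t) (a - b)).
  rewrite in_itv/= => t01; apply: is_derive_along; first exact: is_derive_line.
  by apply: fd; exact: (dP _ (lball _ t01)).1.
pose df (t : R) : R := 'd f (l t) (a - b).
have fl_df (t : R) : t \in `]0, 1[ -> is_derive t 1 (f \o l) (df t).
  by move=> t01; apply: ld; exact: (subset_itv_oo_cc t01).
have fl_cont : {within `[0, 1], continuous (f \o l)}.
  by apply: derivable_within_continuous => t t01; have [] := ld _ t01.
have [t t01] := MVT_segment ler01 fl_df fl_cont.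
have l1 : l 1 = a by rewrite /l scale1r addrC subrK.
have l0 : l 0 = b by rewrite /l scale0r addr0.
rewrite subr0 mulr1 /= l1 l0 /df => -> /=.
have [Ul near_l] := dP _ (lball t t01).
move: (a - b) => w; move: (l t) Ul near_l => y Uy near_y.
have -> : 'd f y w - 'd f v w =
    \sum_j w 0 j *: ('d f y (delta_mx 0 j) - 'd f v (delta_mx 0 j)).
  under eq_bigr do rewrite scalerBr.
  by rewrite sumrB; congr (_ - _); exact: linear_row_sum.
apply: (le_trans (ler_norm_sum _ _ _)).
apply: (@le_trans _ _ (\sum_(j < m) `|w| * (e / m.+1%:R))).
  apply: ler_sum => j _; rewrite normrZ.
  apply: ler_pM => //; first exact: row_entry_le_norm.
  by have := near_y j; rewrite (deriveE _ (fd _ Uy)) (deriveE _ (fd _ Uv)).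
rewrite sumr_const card_ord -[leLHS]mulr_natr -mulrA [leRHS]mulrC ler_wpM2l//.
rewrite -mulrA ler_piMr ?(ltW e0)//.
by rewrite mulrC ler_pdivrMr// mul1r ler_nat.
Unshelve. all: by end_near. Qed.

Lemma strictly_differentiable_row (m k : nat)
    (f D : 'I_k -> 'rV[R]_m -> R) (v : 'rV[R]_m) :
  (forall j, strictly_differentiable (f j) (D j) v) ->
  strictly_differentiable (fun x => \row_j f j x) (fun x => \row_j D j x) v.
Proof.
move=> fD e e0.
have : \forall z \near nbhs (v, v), forall j,
    `|f j z.1 - f j z.2 - D j (z.1 - z.2)| <= e * `|z.1 - z.2|.
  by apply: filter_forall => j; exact: fD.
apply: filterS => z zP.
rewrite [leLHS]/Num.Def.normr/= mx_normrE.
apply: bigmax_le => [|[i j] _]; first by rewrite mulr_ge0// ltW.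
by rewrite !mxE; exact: zP.
Qed.

Lemma strictly_differentiable_linear (m k p : nat)
    (f D : 'rV[R]_m -> 'rV[R]_k) (g : {linear 'rV[R]_k -> 'rV[R]_p})
    (v : 'rV[R]_m) :
  strictly_differentiable f D v ->
  strictly_differentiable (g \o f) (g \o D) v.
Proof.
move=> fD e e0.
have [C C0 gC] := linear_lipschitz (linear_row_continuous (f := g)).
have := fD (e / C) (divr_gt0 e0 C0).
apply: filterS => z zP /=.
rewrite -!linearB/=; apply: (le_trans (gC _)).
by rewrite -ler_pdivlMl// mulrA [C^-1 * e]mulrC.
Qed.

End StrictDifferentiability.

(** * Second derivatives of homogeneous functions *)

Lemma derive1_line (R : realType) (V W : normedModType R) (f : V -> W) (a w : V) :
  derive1 (fun t : R => f (a + t *: w)) 0 = 'D_w f a.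
Proof.
rewrite /derive1 /derive; set g := (fun h : R => _); set g' := (fun h : R => _).
suff -> : g = g' by [].
by apply/funext => t; rewrite /g/= scale0r !addr0 [a + _]addrC.
Qed.

Lemma fundamental_tensorE (R : realType) (V : normedModType R) (f : V -> R)
    (v e h : V) :
  fundamental_tensor f v e h = 2^-1 * 'D_e ('D_h f) v.
Proof.
rewrite /fundamental_tensor -derive1_line.
suff -> : (fun s : R => derive1 (fun t : R => f (v + s *: e + t *: h)) 0) =
  (fun s : R => 'D_h f (v + s *: e)) by [].
by apply/funext => s; exact: derive1_line.
Qed.

Section C2Function.
Context {R : realType} {V : normedModType R}.
Variables (U : set V) (F : V -> R).
Hypotheses (U_open : open U) (F_C2 : Ck_on 2 U F).

Lemma C2_differentiable x : U x -> differentiable F x.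
Proof. exact: F_C2.1. Qed.

Lemma C2_derive_differentiable w x : U x -> differentiable ('D_w F) x.
Proof. exact: (F_C2.2 w).1. Qed.

Lemma C2_derive2_continuous w e x : U x -> {for x, continuous ('D_e ('D_w F))}.
Proof. exact: (F_C2.2 w).2. Qed.

(** At every point of [U] the inner derivative is linear in its direction, being a value of the
    differential of [F]; since [U] is a neighbourhood of [v], the outer derivative inherits this. *)
Lemma hessian_linear_r e v : U v -> linear (fun w => 'D_e ('D_w F) v).
Proof.
move=> Uv a w h.
have dF u : derivable ('D_u F) v e.
  by apply: diff_derivable; exact: C2_derive_differentiable.
rewrite -deriveZ// -deriveD//; last exact: derivableZ.
apply: near_eq_derive; have : \forall y \near v, U y by exact: open_nbhs_nbhs.
apply: filterS => y Uy.
rewrite [RHS](_ : _ = a *: 'D_w F y + 'D_h F y)//.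
by rewrite !deriveE ?linearP//; exact: C2_differentiable.
Qed.

Hypothesis U_cone : forall v (c : R), 0 < c -> U v -> U (c *: v).
Hypothesis F_homogeneous : forall v (c : R), 0 < c -> U v ->
  F (c *: v) = c ^+ 2 * F v.

(** Differentiating [F (c *: y) = c ^+ 2 * F y] in [y] yields a factor [c] on the left by the chain
    rule, which is then cancelled. *)
Lemma derive_homogeneous w v (c : R) : 0 < c -> U v ->
  'D_w F (c *: v) = c * 'D_w F v.
Proof.
move=> c0 Uv; have dFv := C2_differentiable Uv.
have dFcv := C2_differentiable (U_cone c0 Uv).
have : 'D_w (F \o ( *:%R c)) v = 'D_w (c ^+ 2 *: F) v.
  apply: near_eq_derive; have : \forall y \near v, U y by exact: open_nbhs_nbhs.
  by apply: filterS => y Uy /=; rewrite F_homogeneous.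
have dc : differentiable ( *:%R c : V -> V) v by [].
rewrite deriveZ; last exact: diff_derivable.
rewrite deriveE; last exact: differentiable_comp.
rewrite diff_comp//= [X in 'd F _ X](_ : _ = c *: w); last by rewrite diff_val.
rewrite linearZ/= -deriveE// expr2 -scalerA.
by apply: scalerI; rewrite gt_eqF.
Qed.

(** By homogeneity of degree one, ['D_w F] is affine along [v + s *: v = (1 + s) *: v] as long as
    [1 + s > 0]. *)
Lemma hessian_euler w v : U v -> 'D_v ('D_w F) v = 'D_w F v.
Proof.
move=> Uv; rewrite -derive1_line derive1E.
transitivity ('D_1 (fun s : R => 'D_w F v + s *: 'D_w F v) 0).
  apply: near_eq_derive; near=> s.
  rewrite -[X in X + _]scale1r -scalerDl derive_homogeneous// ?scalerDl ?scale1r//.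
    by rewrite mulrDl mul1r.
  rewrite -ltrBlDl sub0r; near: s.
  by apply: lt_nbhsr; rewrite ltrN10.
by have [] := is_derive_line ('D_w F v) ('D_w F v) 0.
Unshelve. all: by end_near. Qed.

End C2Function.

(** * Horizontal vectors of a linear submersion *)

(** The chain rule at 0 on both sides. It serves twice: with [P = F], then with [P] a first
    derivative of [F]. *)
Lemma derive_eq_along_curve (R : realType) (V V' W : normedModType R)
    (f : {linear V -> V'}) (P : V -> W) (Q : V' -> W) (c : R -> V) (v x : V) :
  continuous f -> c 0 = v -> is_derive (0 : R) 1 c x ->
  differentiable P v -> differentiable Q (f v) ->
  (\forall s \near (0 : R), P (c s) = Q (f (c s))) ->
  'D_x P v = 'D_(f x) Q (f v).
Proof.
move=> fc c0 cx dP dQ PQ.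
have df : differentiable f v by exact: linear_differentiable.
have dQf : differentiable (Q \o f) v by exact: differentiable_comp.
have [|_ DP] := @is_derive_along _ _ _ P c 0 x cx; first by rewrite c0.
have [|_ DQ] := @is_derive_along _ _ _ (Q \o f) c 0 x cx; first by rewrite c0.
rewrite (deriveE _ dP) (deriveE _ dQ).
move: DP DQ; rewrite c0 => <-; rewrite (diff_comp df dQ) (diff_lin _ fc) /= => <-.
exact: near_eq_derive.
Qed.

Section LinearSubmersion.
Context {R : realType} {m n : nat}.
Variables (f : {linear 'rV[R]_m -> 'rV[R]_n}).
Variables (U : set 'rV[R]_m) (F : 'rV[R]_m -> R).
Hypotheses (U_open : open U) (F_C2 : Ck_on 2 U F).

(* When [f] is the differential of a submersion at p and [F] the restriction of
   the metric to T_pM, Euler's identity makes [critical] the horizontality of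
   u, and [hessian_ortho] the g_u-orthogonality of x to the vertical space. *)
Definition critical (u : 'rV[R]_m) : Prop :=
  U u /\ forall w, f w = 0 -> 'D_w F u = 0.

Definition hessian_ortho (u x : 'rV[R]_m) : Prop :=
  forall w, f w = 0 -> 'D_x ('D_w F) u = 0.

Section AtCriticalPoint.
Variable v : 'rV[R]_m.
Hypotheses (v_crit : critical v)
  (v_nondeg : forall w, f w = 0 -> hessian_ortho v w -> w = 0).

Let k := \rank (kermx (lin1_mx f)).
Let K : 'M[R]_(k, m) := row_base (kermx (lin1_mx f)).

Let kerP w : f w = 0 <-> exists z, w = z *m K.
Proof.
have -> : f w = 0 <-> (w <= K)%MS.
  rewrite eq_row_base -(mul_rV_lin1 f) sub_kermx.
  by split=> [/eqP|/eqP].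
split=> [/submxP[z ->]|[z ->]]; [by exists z|exact: submxMl].
Qed.

Let f_row j : f (row j K) = 0.
Proof. by apply/kerP; exists (delta_mx 0 j); rewrite rowE. Qed.

(** The rows of [K] form a basis of the kernel of [f], so the zeros of [Phi] in [U] are the critical
    points. For row vectors, [B] is the matrix of the derivative of [Phi] at [v], and [N] is the
    Gram matrix of the Hessian on the kernel. Once [N] is invertible, [T] sends [y] to the kernel
    vector whose product with [B] is [y]. *)
Let Phi (y : 'rV[R]_m) : 'rV[R]_k := \row_j 'D_(row j K) F y.
Let B : 'M[R]_(m, k) :=
  \matrix_(i, j) 'd ('D_(row j K) F) v (delta_mx 0 i).
Let N : 'M[R]_k := K *m B.
Let T : 'M[R]_(k, m) := invmx N *m K.

Let mulB w : w *m B = \row_j 'd ('D_(row j K) F) v w.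
Proof.
apply/rowP => j; rewrite !mxE; apply: esym; apply: etrans (linear_row_sum _ _) _.
by apply: eq_bigr => i _; rewrite mxE.
Qed.

Let mulBE w j : (w *m B) 0 j = 'D_w ('D_(row j K) F) v.
Proof.
rewrite mulB mxE deriveE//.
by apply: (C2_derive_differentiable F_C2); exact: v_crit.1.
Qed.

(** Linearity of the Hessian in the inner direction reduces orthogonality to a test on the rows of
    [K]. *)
Let orthoP w : hessian_ortho v w <-> w *m B = 0.
Proof.
split=> [wo|wB]; first by apply/rowP => j; rewrite mulBE mxE; exact: wo.
move=> w' /kerP[z ->].
pose h := HB.pack_for {linear 'rV[R]_m -> R} (fun u => 'D_w ('D_u F) v)
  (GRing.isLinear.Build _ _ _ _ _ (hessian_linear_r U_open F_C2 w v_crit.1)).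
have -> : 'D_w ('D_(z *m K) F) v = h (z *m K) by [].
rewrite mulmx_sum_row linear_sum big1// => j _.
have hj : h (row j K) = 0.
  by rewrite [LHS](_ : _ = (w *m B) 0 j) ?mulBE// -mulBE wB mxE.
by rewrite linearZ_LR hj; exact: mulr0.
Qed.

(** If [z *m N = 0], then [z *m K] lies in the kernel of [f] and is orthogonal to it, so
    nondegeneracy kills it; the rows of [K] being independent, [z = 0]. *)
Let N_unit : N \in unitmx.
Proof.
rewrite -row_free_unit -kermx_eq0; apply/eqP/row_matrixP => i; rewrite row0.
set z := row i _.
have zN : z *m K *m B = 0.
  by rewrite -mulmxA; apply/eqP; rewrite -sub_kermx row_sub.
have /(row_free_inj (row_base_free _)) : z *m K = 0 *m K; last by [].
rewrite mul0mx; apply: v_nondeg; first by apply/kerP; exists z.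
exact/orthoP.
Qed.

Let T_inj (y : 'rV[R]_k) : y *m T = 0 -> y = 0.
Proof.
rewrite mulmxA => yT.
have /(row_free_inj (row_base_free _)) : y *m invmx N *m K = 0 *m K.
  by rewrite yT mul0mx.
by move=> /(congr1 (mulmxr N)); rewrite /= mul0mx mulmxKV.
Qed.

Let TBT : T *m B *m T = T.
Proof. by rewrite -[T *m B]mulmxA mulVmx// mul1mx. Qed.

(** Right multiplication by [B *m T] is the Hessian-orthogonal projection onto the kernel, because
    [T *m B *m T = T] and [T] is injective. *)
Lemma kernel_ortho_decomposition e :
  exists2 w, f w = 0 & hessian_ortho v (e - w).
Proof.
exists (e *m B *m T); first by apply/kerP; exists (e *m B *m invmx N); rewrite mulmxA.
apply/orthoP/T_inj; rewrite !mulmxBl.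
by rewrite -(mulmxA (e *m B) T B) -(mulmxA (e *m B) (T *m B) T) TBT subrr.
Qed.

(* [Theta] below has the same zeros as [Phi], and its derivative [B T] is a
   projection onto the kernel of [f]. *)
Lemma critical_curve x : hessian_ortho v x -> exists c : R -> 'rV[R]_m,
  [/\ c 0 = v, is_derive (0 : R) 1 c x & \forall s \near (0 : R), critical (c s)].
Proof.
move=> /orthoP xB.
have Uv := v_crit.1.
have PhiP y : U y -> Phi y = 0 -> critical y.
  move=> Uy Phi0; split=> // w /kerP[z ->].
  rewrite (deriveE _ (C2_differentiable F_C2 Uy)) mulmx_sum_row linear_sum.
  rewrite big1// => j _; rewrite linearZ/= -deriveE.
    by have /rowP/(_ j) := Phi0; rewrite !mxE => ->; rewrite scaler0.
  exact: (C2_differentiable F_C2).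
pose Theta := mulmxr T \o Phi.
have Theta_sdiff :
    strictly_differentiable Theta (mulmxr (B *m T)) v.
  have -> : (mulmxr (B *m T) : 'rV[R]_m -> 'rV[R]_m) =
      mulmxr T \o (fun w => \row_j 'd ('D_(row j K) F) v w).
    by apply/funext => w /=; rewrite mulmxA mulB.
  apply: strictly_differentiable_linear; apply: strictly_differentiable_row => j.
  apply: (C1_strictly_differentiable U_open Uv) => [y|w].
    exact: (C2_derive_differentiable F_C2).
  exact: (C2_derive2_continuous F_C2).
have [c [c0 cx cTheta]] : exists c : R -> 'rV[R]_m, [/\ c 0 = v,
    is_derive (0 : R) 1 c x &
    \forall s \near (0 : R), Theta (c s) = 0].
  apply: (implicit_curve _ Theta_sdiff).
  - exact: linear_row_continuous.
  - by move=> a; rewrite /Theta /= -mulmxA [T *m _]mulmxA TBT.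
  - rewrite /Theta /= [Phi v](_ : _ = 0) ?mul0mx//.
    by apply/rowP => j; rewrite !mxE; apply: v_crit.2.
  - by rewrite /= mulmxA xB mul0mx.
exists c; split=> //.
(* Being critical includes lying in [U], which is open and contains [c 0]. *)
have cc : {for 0, continuous c}.
  by apply: differentiable_continuous; apply/derivable1_diffP; case: cx.
have cU : \forall s \near (0 : R), U (c s).
  by apply: cc; rewrite c0; exact: open_nbhs_nbhs.
near=> s; apply: PhiP; first by near: s.
by apply: T_inj; near: s; exact: cTheta.
Unshelve. all: by end_near. Qed.

End AtCriticalPoint.

Variables (U' : set 'rV[R]_n) (F' : 'rV[R]_n -> R).
Hypotheses (F'_C2 : Ck_on 2 U' F').
Hypothesis critical_nondegenerate :
  forall u, critical u -> forall w, f w = 0 -> hessian_ortho u w -> w = 0.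
Hypothesis critical_isometric :
  forall u, critical u -> U' (f u) /\ F u = F' (f u).

(** The kernel component of [e] contributes 0 to both sides, and the orthogonal component is the
    velocity of a critical curve. The identity is stated at all critical points because it is itself
    differentiated along such a curve below. *)
Lemma derive_critical u e : critical u -> 'D_e F u = 'D_(f e) F' (f u).
Proof.
move=> uc.
have [w fw0 eo] := kernel_ortho_decomposition uc (critical_nondegenerate uc) e.
have [c [c0 cx cc]] := critical_curve uc (critical_nondegenerate uc) eo.
have dF := C2_differentiable F_C2 uc.1.
have <- : f (e - w) = f e by rewrite linearB /= fw0 subr0.
have -> : 'D_e F u = 'D_(e - w) F u.
  have : 'd F u (e - w) = 'd F u e - 'd F u w by rewrite linearB.
  by rewrite -!(deriveE _ dF) (uc.2 w fw0) subr0 => ->.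
apply: (derive_eq_along_curve _ c0 cx) => //.
- exact: linear_row_continuous.
- by apply: (C2_differentiable F'_C2); case: (critical_isometric uc).
- by apply: filterS cc => s /critical_isometric[].
Qed.

Lemma hessian_critical v x e : critical v -> hessian_ortho v x ->
  'D_x ('D_e F) v = 'D_(f x) ('D_(f e) F') (f v).
Proof.
move=> vc xo.
have [c [c0 cx cc]] := critical_curve vc (critical_nondegenerate vc) xo.
apply: (derive_eq_along_curve _ c0 cx) => //.
- exact: linear_row_continuous.
- by apply: (C2_derive_differentiable F_C2); exact: vc.1.
- by apply: (C2_derive_differentiable F'_C2); case: (critical_isometric vc).
- by apply: filterS cc => s /derive_critical.
Qed.

End LinearSubmersion.

(** * Restriction to a tangent space, in coordinates *)

(** The derivative of the slice in direction [w] is the slice of the derivative of [f] in direction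
    [(0, w)], so induction on [k] applies. *)
Lemma Ck_on_slice (R : realType) (V V' W : normedModType R) (k : nat)
    (S : set (V * V')) (f : V * V' -> W) (a : V) :
  Ck_on k S f -> Ck_on k [set y | S (a, y)] (fun y => f (a, y)).
Proof.
elim: k f => [|k IH] f /=.
  move=> fc y Sy; apply: (@continuous_comp _ _ _ (fun y => (a, y)) f); last exact: fc.
  by apply: cvg_pair; [exact: cvg_cst|exact: cvg_id].
move=> [fd fD]; split=> [y Sy|w].
  apply: (@differentiable_comp _ _ _ _ (fun y => (a, y)) f); last exact: fd.
  by apply: differentiable_pair.
rewrite (_ : 'D_w _ = fun y => 'D_((0, w) : V * V') f (a, y)).
  exact: (IH _ (fD _)).
apply/funext => y; rewrite /derive.
set g := (fun h : R => _); set g' := (fun h : R => _).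
suff -> : g = g' by [].
apply/funext => h; rewrite /g /g'; congr (_ *: (f _ - _)).
by congr pair; rewrite /= scaler0 add0r.
Qed.

Section TangentCoordinates.
Context {R : realType} {m : nat} {M : manifold R m} {i : chart M} {p : M}.
Hypothesis ip : dom i p.

(** The transition map from [i] to itself agrees with the identity on the open image of the chart,
    hence near the point, and so has the same differential there. *)
Lemma component_of_componentK y : tangent_of_component i p y i = y.
Proof.
rewrite /= /tangent_of_component_fun; case: asboolP => [_|[]//].
have -> : 'd (Defs.coord i \o param i) (Defs.coord i p) y = 'd id (Defs.coord i p) y.
  apply: eq_near_diff => //.
    exact: (local_expr_differentiable (@id_smooth R m M) ip ip).
  have : \forall z \near Defs.coord i p, (Defs.coord i @` dom i) z.
    by apply: open_nbhs_nbhs; split; [exact: codom_open|exists p].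
  by apply: filterS => _ [q iq <-]; rewrite /= coordK.
by rewrite diff_val.
Qed.

Lemma tangent_of_componentK (X : tangent p) : tangent_of_component i p (X i) = X.
Proof.
apply/val_inj/funext => j /=; rewrite /tangent_of_component_fun.
have [X0 XE] := asboolP _ (componentP X).
case: asboolP => [[_ jp]|nip]; first by rewrite -XE.
by rewrite X0// => jp; exact: nip.
Qed.

Lemma component_inj (X Y : tangent p) : X i = Y i -> X = Y.
Proof.
by move=> XY; rewrite -[X]tangent_of_componentK XY tangent_of_componentK.
Qed.

(** Taking the component in [i] is linear and inverted by [tangent_of_component], so the same
    function of [s] and [t] is differentiated on both sides. *)
Lemma fundamental_tensor_component (Q : tangent p -> R) v e h :
  fundamental_tensor Q v e h =
  fundamental_tensor (Q \o tangent_of_component i p) (v i) (e i) (h i).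
Proof.
rewrite /fundamental_tensor; suff -> : (fun s : R =>
    derive1 (fun t : R => Q (v + s *: e + t *: h)) 0) = (fun s : R =>
    derive1 (fun t : R => (Q \o tangent_of_component i p)
                            (v i + s *: e i + t *: h i)) 0) by [].
apply/funext => s; suff -> : (fun t : R => Q (v + s *: e + t *: h)) =
  (fun t : R => (Q \o tangent_of_component i p)
                  (v i + s *: e i + t *: h i)) by [].
by apply/funext => t /=; rewrite -[in LHS](tangent_of_componentK (_ + _)).
Qed.

Lemma bundle_fun_coord (Q : tangent_fun M) y :
  bundle_fun Q i (Defs.coord i p, y) = Q p (tangent_of_component i p y).
Proof. by rewrite /bundle_fun /= coordK. Qed.

Lemma bundle_set_coord (A : tangent_set M) y :
  bundle_set A i (Defs.coord i p, y) <-> A p (tangent_of_component i p y).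
Proof.
by rewrite /bundle_set /= coordK//; split=> [[]//|Ay]; split=> //; exists p.
Qed.

Section PseudoFinsler.
Variables (A : tangent_set M) (L : tangent_fun M).
Hypothesis hL : pseudo_finsler A L.

Let U := [set y | @A p (tangent_of_component i p y)].
Let F := @L p \o tangent_of_component i p.

(** Fixing the base point makes the tangent space a slice of the bundle chart, from which openness
    and smoothness are inherited. *)
Let U_slice : U = [set y | bundle_set A i (Defs.coord i p, y)].
Proof. by apply/seteqP; split=> y; apply bundle_set_coord. Qed.

Lemma pseudo_finsler_open : open U.
Proof.
rewrite U_slice; apply: (@open_comp _ _ (fun y => (Defs.coord i p, y)) (bundle_set A i)).
  move=> y _; apply: (@cvg_pair _ _ _ (nbhs y) (nbhs (Defs.coord i p)) (nbhs y)).
    exact: cvg_cst.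
  exact: cvg_id.
exact: (pf_open hL).
Qed.

Lemma pseudo_finsler_C2 : Ck_on 2 U F.
Proof.
rewrite U_slice (_ : F = fun y => bundle_fun L i (Defs.coord i p, y)).
  exact/Ck_on_slice/(pf_smooth hL).
by apply/funext => y; rewrite bundle_fun_coord.
Qed.

Let component_scale y (c : R) :
  tangent_of_component i p (c *: y) = c *: tangent_of_component i p y.
Proof.
apply: component_inj; rewrite component_of_componentK.
by rewrite [RHS](_ : _ = c *: tangent_of_component i p y i)// component_of_componentK.
Qed.

Lemma pseudo_finsler_cone y (c : R) : 0 < c -> U y -> U (c *: y).
Proof. by rewrite /U/= component_scale; exact: (pf_cone hL). Qed.

Lemma pseudo_finsler_homogeneous y (c : R) : 0 < c -> U y ->
  F (c *: y) = c ^+ 2 * F y.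
Proof. by rewrite /U/F/= component_scale; exact: (pf_homogeneous hL). Qed.

End PseudoFinsler.

End TangentCoordinates.

(** * The submersion in coordinates at a point *)

Section SubmersionCoordinates.
Context {R : realType} {m n : nat} {M : manifold R m} {B : manifold R n}.
Variables (A : tangent_set M) (L : tangent_fun M) (sigma : smooth_map M B).
Hypothesis hL : pseudo_finsler A L.
Variables (i : chart M) (j : chart B) (p : M).
Hypotheses (ip : dom i p) (jp : dom j (sigma p)).

Let f := 'd (local_expr sigma i j) (Defs.coord i p).
Let U := [set y | @A p (tangent_of_component i p y)].
Let F := @L p \o tangent_of_component i p.

Lemma vertical_component (w : tangent p) :
  vertical sigma p w <-> f (w i) = 0.
Proof.
rewrite /f -dmapE//; split=> [->//|fw].
exact: (component_inj jp).
Qed.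

Lemma orthogonal_component (v x : tangent p) :
  orthogonal_to (fundamental_tensor (@L p) v) (vertical sigma p) x <->
  hessian_ortho f F (v i) (x i).
Proof.
split=> [xo w fw|xo w /vertical_component fw].
  have := xo (tangent_of_component i p w).
  rewrite (fundamental_tensor_component ip) component_of_componentK//.
  rewrite fundamental_tensorE => /(_ _)/eqP; rewrite mulf_eq0 invr_eq0 pnatr_eq0/=.
  by move=> H; apply/eqP/H/vertical_component; rewrite component_of_componentK.
by rewrite (fundamental_tensor_component ip) fundamental_tensorE (xo _ fw) mulr0.
Qed.

Lemma horizontal_component (v : tangent p) :
  horizontal A L sigma v <-> critical f U F (v i).
Proof.
have AU : @A p v <-> U (v i) by rewrite /U/= tangent_of_componentK.
have euler w : U (v i) -> 'D_(v i) ('D_w F) (v i) = 'D_w F (v i).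
  exact: (hessian_euler (pseudo_finsler_open ip hL) (pseudo_finsler_C2 ip hL)
    (pseudo_finsler_cone ip hL) (pseudo_finsler_homogeneous ip hL)).
split=> [[/AU Uv /orthogonal_component vo]|[Uv vc]].
  by split=> // w fw; rewrite -euler//; exact: vo.
split; first exact/AU.
by apply/orthogonal_component => w fw; rewrite euler//; exact: vc.
Qed.

End SubmersionCoordinates.

Theorem lemma3 (R : realType) (m n : nat) (M : manifold R m) (B : manifold R n)
    (A : tangent_set M) (L : tangent_fun M)
    (A' : tangent_set B) (L' : tangent_fun B) (sigma : smooth_map M B)
    (hL : pseudo_finsler A L) (hL' : pseudo_finsler A' L')
    (hsigma : pseudo_finsler_submersion A L A' L' sigma)
    (hV : forall (p : M) (v : tangent p), horizontal A L sigma v ->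
      nondegenerate_on (fundamental_tensor (L p) v) (vertical sigma p))
    (p : M) (v : tangent p) (hv : horizontal A L sigma v) :
  let g := fundamental_tensor (L p) v in
  let g' := fundamental_tensor (L' (sigma p)) (dmap sigma p v) in
  pseudo_riemannian_submersion g g' (dmap sigma p) /\
  (forall x : tangent p, orthogonal_to g (vertical sigma p) x ->
    forall e : tangent p, g x e = g' (dmap sigma p x) (dmap sigma p e)).
Proof.
move=> g g'.
(* The isometry condition is the case of this formula in which [e] is orthogonal too. *)
suff gE x : orthogonal_to g (vertical sigma p) x ->
    forall e, g x e = g' (dmap sigma p x) (dmap sigma p e).
  split; last exact: gE.
  split; first exact: pfs_dmap_surjective hsigma p.
    exact: hV.
  by move=> x y xo _; exact: gE.
have ip := dom_chart_at p; have jp := dom_chart_at (sigma p).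
set i := chart_at p in ip; set j := chart_at (sigma p) in jp.
move=> xo e; rewrite /g /g' (fundamental_tensor_component ip).
rewrite (fundamental_tensor_component jp) !(dmapE _ ip jp) !fundamental_tensorE.
apply: (congr1 ( *%R 2^-1)).
pose f := 'd (local_expr sigma i j) (Defs.coord i p).
have f_component (X : tangent p) : f (X i) = dmap sigma p X j.
  by rewrite (dmapE _ ip jp).
apply: (@hessian_critical _ _ _ f _ _ (pseudo_finsler_open ip hL)
  (pseudo_finsler_C2 ip hL) _ _ (pseudo_finsler_C2 jp hL')).
(* Each coordinate vector [u] is the component of a tangent vector at [p], which is horizontal when
   [u] is critical; nondegeneracy on vertical vectors then transfers. *)
- move=> u; rewrite -(component_of_componentK ip u).
  move=> /(horizontal_component hL ip jp) uh w.
  rewrite -(component_of_componentK ip w) => /(vertical_component ip jp) wv.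
  move=> /(orthogonal_component L ip jp) wo.
  by rewrite (hV _ _ uh _ wv wo).
- move=> u; rewrite -(component_of_componentK ip u).
  move=> /(horizontal_component hL ip jp) /(pfs_horizontal hsigma).
  move: (tangent_of_component i p u) => X; rewrite f_component /comp /mkset.
  by rewrite (tangent_of_componentK ip) (tangent_of_componentK jp).
- exact/horizontal_component.
- exact/orthogonal_component.
Qed.
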